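(* Let $X$ and $Y$ be random variables represented in tensor train format by support and mass tensors depending on ancestral variables indexed by $\mathcal{I}_X$ and $\mathcal{I}_Y$ respectively, and let $Z=XY$, with support tensor $\mathcal{S}_Z$ and mass tensor $\mathcal{M}_Z$ over $\mathcal{I}=\mathcal{I}_X\cup\mathcal{I}_Y$. Then $$\mathrm{Cov}^{\mathrm{disc}}(X,Y)=\frac{\langle\mathcal{S}_Z,\mathcal{M}_Z\rangle}{\langle\mathbf{1},\mathcal{M}_Z\rangle}-\mu_X^{\mathrm{disc}}\,\mu_Y^{\mathrm{disc}},$$ where $\mu_X^{\mathrm{disc}}=\langle\mathcal{S}_X,\mathcal{M}_X\rangle/\langle\mathbf{1},\mathcal{M}_X\rangle$ and $\mu_Y^{\mathrm{disc}}=\langle\mathcal{S}_Y,\mathcal{M}_Y\rangle/\langle\mathbf{1},\mathcal{M}_Y\rangle$ are the first moments of the discrete representations of $X$ and $Y$.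
   Context: Ancestral variables: for each $k$ in a finite index set $\mathcal{I}=\mathcal{I}_X\cup\mathcal{I}_Y$ there is an independent random variable $A_k$ with a discrete representation having $n_k$ support points and masses $\mathbf{m}^{(k)}_{i}\ge0$, $1\le i\le n_k$, $\sum_i\mathbf{m}^{(k)}_i=1$. The variable $X$ is represented by a support tensor $\mathcal{S}_X$, whose entry at $(i_k)_{k\in\mathcal{I}_X}$ is the value of $X$ when each $A_k$ takes its $i_k$-th support point, and the mass tensor $\mathcal{M}_X$ with entries $\prod_{k\in\mathcal{I}_X}\mathbf{m}^{(k)}_{i_k}$; similarly $\mathcal{S}_Y,\mathcal{M}_Y$ over $\mathcal{I}_Y$. The sets $\mathcal{I}_X$ and $\mathcal{I}_Y$ may overlap (shared ancestors, i.e. correlated $X,Y$). Product: $Z=XY$ is represented over $\mathcal{I}$ by first extending $\mathcal{S}_X,\mathcal{S}_Y$ to all indices in $\mathcal{I}$ (constant in the absent indices) and multiplying entrywise: $(\mathcal{S}_Z)_{(i_k)_{k\in\mathcal{I}}}=(\mathcal{S}_X)_{(i_k)_{k\in\mathcal{I}_X}}(\mathcal{S}_Y)_{(i_k)_{k\in\mathcal{I}_Y}}$; the joint mass tensor is $(\mathcal{M}_Z)_{(i_k)_{k\in\mathcal{I}}}=\prod_{k\in\mathcal{I}}\mathbf{m}^{(k)}_{i_k}$. In tensor train (TT) format, meaning that each entry is a product of matrix slices $\mathbf{G}^{(k)}_{i_k}\in\mathbb{R}^{r_{k-1}\times r_k}$ of cores with boundary ranks $1$, the extension inserts cores all of whose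 slices are identity matrices, and the entrywise product has core slices given by the Kronecker products of the slices of the two aligned factors. $\mathrm{Cov}^{\mathrm{disc}}(X,Y)=\mathbb{E}[XY]-\mathbb{E}[X]\mathbb{E}[Y]$ denotes the covariance under the discrete joint distribution in which the index $(i_k)_{k\in\mathcal{I}}$ has probability $\prod_{k\in\mathcal{I}}\mathbf{m}^{(k)}_{i_k}$ and $X,Y$ take the corresponding entries of $\mathcal{S}_X,\mathcal{S}_Y$. $\mathbf{1}$ is the all-ones tensor and $\langle\mathcal{A},\mathcal{B}\rangle$ is the sum of products of corresponding entries. *)

(* Defs.v *)
From mathcomp Require Import all_boot all_order all_algebra.
From mathcomp Require Import mxtens.
From mathcomp Require Import all_classical all_reals all_analysis.

Set Implicit Arguments.
Unset Strict Implicit.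
Unset Printing Implicit Defensive.

Import Order.TTheory GRing.Theory Num.Theory.

Local Open Scope ring_scope.

Section TensorTrain.
Variables (R : realType) (I : finType) (n : I -> nat).

(* Multi-indices over the modes occurring in the list [s]. *)
Definition midx (s : seq I) : finType :=
  {dffun forall k : {k : I | k \in s}, 'I_(n (val k))}.

Definition midx_restrict (s t : seq I) (ts : {subset t <= s}) (i : midx s) :
    midx t :=
  finfun (fun k : {k : I | k \in t} =>
    i (exist _ (val k) (ts _ (valP k))) : 'I_(n (val k))).

Definition tensor (s : seq I) : Type := midx s -> R.

Definition ones (s : seq I) : tensor s := fun _ => 1.

Definition inner (s : seq I) (A B : tensor s) : R := \sum_(i : midx s) A i * B i.

Definition first_moment (s : seq I) (S M : tensor s) : R :=
  inner S M / inner (@ones s) M.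

Definition mass_tensor (m : forall k, 'I_(n k) -> R) (s : seq I) : tensor s :=
  fun i => \prod_(k : {k : I | k \in s}) m (val k) (i k).

(* A train with leading rank [r]: one core per mode of [s], in the order of
   [s], the right rank of each core being the left rank of the next one and
   the last rank being 1.  Trains with both boundary ranks 1 are [tt s 1]. *)
Fixpoint tt (s : seq I) (r : nat) : Type :=
  if s is k :: s' then
    {r' : nat & (('I_(n k) -> 'M[R]_(r, r')) * tt s' r')%type}
  else r = 1%N.

Definition tt_cons (k : I) (s : seq I) (r r' : nat)
    (G : 'I_(n k) -> 'M[R]_(r, r')) (T : tt s r') : tt (k :: s) r :=
  existT _ r' (G, T).

Fixpoint tt_prod (s : seq I) :
    forall r, tt s r -> (forall k, k \in s -> 'I_(n k)) -> 'M[R]_(r, 1) :=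
  match s with
  | [::] => fun r (e : r = 1%N) _ => castmx (esym e, erefl 1%N) 1%:M
  | k :: s' => fun r (T : tt (k :: s') r) i =>
      let: existT r' (G, T') := T in
      G (i k (mem_head k s'))
        *m tt_prod T' (fun l (ls : l \in s') => i l (@mem_behead I (k :: s') l ls))
  end.

Definition tt_tensor (s : seq I) (T : tt s 1) : tensor s :=
  fun i => tt_prod T (fun k (ks : k \in s) => i (exist _ k ks)) 0 0.

(* Extension to all the modes of [s] of a train over the modes lying in [J]:
   the cores of the absent modes have identity slices. *)
Fixpoint tt_extend (J : {set I}) (s : seq I) :
    forall r, tt [seq k <- s | k \in J] r -> tt s r :=
  match s with
  | [::] => fun r T => T
  | k :: s' => fun r =>
      (if k \in J as b
         return (tt (if b then k :: [seq l <- s' | l \in J]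
                     else [seq l <- s' | l \in J]) r -> tt (k :: s') r)
       then fun T => let: existT r' (G, T') := T in
                     tt_cons G (@tt_extend J s' r' T')
       else fun T => tt_cons (fun _ => 1%:M) (@tt_extend J s' r T))
  end.

(* The leading ranks multiply; at the end of the train 1 * 1 reduces to 1. *)
Fixpoint tt_mul (s : seq I) :
    forall r1 r2, tt s r1 -> tt s r2 -> tt s (r1 * r2)%N :=
  match s with
  | [::] => fun r1 r2 (e1 : r1 = 1%N) (e2 : r2 = 1%N) => f_equal2 muln e1 e2
  | k :: s' => fun r1 r2 (T1 : tt (k :: s') r1) (T2 : tt (k :: s') r2) =>
      let: existT r1' (G1, T1') := T1 in
      let: existT r2' (G2, T2') := T2 in
      tt_cons (fun i => G1 i *t G2 i) (tt_mul T1' T2')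
  end.

Definition modes (J : {set I}) : seq I := [seq k <- enum I | k \in J].

Lemma modes_sub (J : {set I}) : {subset modes J <= enum I}.
Proof. exact/mem_subseq/filter_subseq. Qed.

Definition tt_product (JX JY : {set I}) (SX : tt (modes JX) 1)
    (SY : tt (modes JY) 1) : tt (enum I) 1 :=
  tt_mul (tt_extend SX) (tt_extend SY).

(* [A] is the random multi-index of the support points taken by the ancestral
   variables; they are independent with masses [m], so its law is the product
   of the [m k]. *)
Definition has_joint_masses (m : forall k, 'I_(n k) -> R)
    (d : measure_display) (Omega : measurableType d) (P : probability Omega R)
    (A : Omega -> midx (enum I)) : Prop :=
  forall i : midx (enum I),
    measurable (A @^-1` [set i])%classic /\
    P (A @^-1` [set i])%classic = (mass_tensor m i)%:E.

(* The random variable whose value is the entry of [S] selected by [A]. *)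
Definition tensor_rv (Omega : Type) (A : Omega -> midx (enum I))
    (J : {set I}) (S : tensor (modes J)) : Omega -> R :=
  fun w => S (midx_restrict (@modes_sub J) (A w)).

End TensorTrain.

Arguments ones {R I n s} i.

(* Main.v *)
Require Import Defs.
From mathcomp Require Import all_boot all_order all_algebra.
From mathcomp Require Import mxtens.
From mathcomp Require Import all_classical all_reals all_analysis.
From mathcomp Require Import ring.

(* The cores of the product train are Kronecker products, and
   (A *t B) *m (C *t D) = (A *m C) *t (B *m D), so the entry of S_Z at a
   multi-index is the product of the entries of S_X and S_Y at its restrictions.
   Since each mass vector sums to 1, summing the joint mass tensor over the modes
   absent from a subset leaves the mass tensor of that subset; hence the moments
   of X and Y over their own modes are expectations under the joint law, and the
   covariance expands as usual. *)

Import Order.TTheory GRing.Theory Num.Theory.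

Local Open Scope ring_scope.

(** Identity slices drop out of the matrix product. Agreement of [i] and [j] is required for all
    membership proofs, so the induction never has to compare such proofs. *)
Lemma tt_prod_extend {R : realType} {I : finType} {n : I -> nat} (J : {set I})
    (s : seq I) (r : nat) (T : tt R n [seq k <- s | k \in J] r)
    (i : forall k, k \in s -> 'I_(n k))
    (j : forall k, k \in [seq k <- s | k \in J] -> 'I_(n k)) :
  (forall k ks kJ, i k ks = j k kJ) ->
  tt_prod (tt_extend T) i = tt_prod T j.
Proof.
elim: s r T i j => [|k s IHs] r /=; first by case: _ /.
case: (k \in J) => T i j ij.
  case: T => r' [G T] /=.
  by congr (G _ *m _); [exact: ij | apply: IHs => l ls lJ; exact: ij].
by rewrite /tt_cons /= mul1mx; apply: IHs => l ls lJ; apply: ij.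
Qed.

(** The ascribed type relies on [1 * 1] computing to [1]. The leading ranks stay arbitrary because
    they vary along the induction. *)
Lemma tt_prod_mul {R : realType} {I : finType} {n : I -> nat} (s : seq I)
    (r1 r2 : nat) (T1 : tt R n s r1) (T2 : tt R n s r2)
    (i : forall k, k \in s -> 'I_(n k)) :
  tt_prod (tt_mul T1 T2) i = tt_prod T1 i *t tt_prod T2 i :> 'M[R]_(r1 * r2, 1 * 1).
Proof.
elim: s r1 r2 T1 T2 i => [|k s IHs] r1 r2 /=.
  by move=> e1 e2 _; subst r1 r2; rewrite tens_scalar1mx !castmx_id.
case=> r1' [G1 T1] [r2' [G2 T2]] i /=.
by rewrite /tt_cons /= IHs; apply: tensmx_mul.
Qed.

Lemma tt_tensor_product {R : realType} {I : finType} {n : I -> nat}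
    (JX JY : {set I}) (SX : tt R n (modes JX) 1) (SY : tt R n (modes JY) 1)
    (i : midx n (enum I)) :
  tt_tensor (tt_product SX SY) i =
    tt_tensor SX (midx_restrict (@modes_sub I JX) i) *
    tt_tensor SY (midx_restrict (@modes_sub I JY) i).
Proof.
have extE J (S : tt R n (modes J) 1) :
    tt_prod (tt_extend S) (fun k ks => i (exist _ k ks)) 0 0 =
    tt_tensor S (midx_restrict (@modes_sub I J) i).
  rewrite /tt_tensor; congr (fun_of_matrix _ 0 0).
  apply: tt_prod_extend => k ks kJ; rewrite ffunE /=.
  by congr (i (exist _ k _)); apply: bool_irrelevance.
(* The product of two scalar entries is an entry of the Kronecker product, at an encoded pair of
   indices whose value is 0. *)
rewrite -!extE -tensmxE -tt_prod_mul.
by congr (fun_of_matrix _ _ _); apply/val_inj.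
Qed.

Lemma sum_dffun_prod {R : comNzRingType} {I : finType} {T_ : I -> finType}
    (Q : forall i, pred (T_ i)) (F : forall i, T_ i -> R) :
  \sum_(f : {dffun forall i, T_ i} | [forall i, Q i (f i)]) \prod_i F i (f i) =
  \prod_i \sum_(x | Q i x) F i x.
Proof.
(* Extending by zero outside [Q] moves the constraint from the index set into the summand. *)
pose G i : {ffun T_ i -> R} := [ffun x => if Q i x then F i x else 0].
transitivity (\prod_i \sum_x G i x); last first.
  by apply: eq_bigr => i _; rewrite [RHS]big_mkcond; apply: eq_bigr => x _; rewrite ffunE.
(* Tagging gives all the factors a common index type, so that the non-dependent distributivity law
   applies. *)
under [RHS]eq_bigr do rewrite (big_tag (fun i x => G i x)).
rewrite bigA_distr_big_dep -big_fprod big_mkcond /=.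
rewrite [RHS](reindex (@fprod_of_dffun I T_)) /=; last first.
  exact/onW_bij/fprod_of_dffun_bij.
apply: eq_bigr => f _; under [RHS]eq_bigr do rewrite ffunE fprodE.
case: ifPn => [/forallP Qf|/forallPn[i /negPf nQ]].
  by apply: eq_bigr => i _; rewrite Qf.
by rewrite (bigD1 i) //= nQ mul0r.
Qed.

(** Marginalisation: the fiber is a box, fixed in the modes of [t] and free in the others, so the
    sum factors mode by mode. A fixed mode contributes its mass at [j], a free one contributes 1. *)
Lemma sum_mass_tensor_fiber {R : realType} {I : finType} {n : I -> nat}
    {m : forall k, 'I_(n k) -> R} (m_sum1 : forall k, \sum_(i < n k) m k i = 1)
    {s t : seq I} (ts : {subset t <= s}) (j : midx n t) :
  \sum_(i : midx n s | midx_restrict ts i == j) mass_tensor m i =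
  mass_tensor m j.
Proof.
(* Quantifying over the proof of [val k \in t] makes the constraint vacuous at modes outside [t]. *)
pose Q (k : {k | k \in s}) (x : 'I_(n (val k))) :=
  `[< forall kt : val k \in t, x = j (exist _ (val k) kt) >].
transitivity (\sum_(i : midx n s | [forall k, Q k (i k)]) mass_tensor m i).
  apply: eq_bigl => i; apply/eqP/forallP => [ij k|Qi].
    apply/asboolP => kt; rewrite -ij ffunE /=.
    by case: k kt => k ks kt /=; congr (i (exist _ k _)); apply: bool_irrelevance.
  apply/ffunP => -[k kt]; rewrite ffunE /=.
  have /asboolP/(_ kt) /= <- := Qi (exist _ k (ts _ kt)).
  by congr (i (exist _ k _)); apply: bool_irrelevance.
rewrite /mass_tensor (sum_dffun_prod Q (fun k => m (val k))).
rewrite (bigID (fun k : {k | k \in s} => val k \in t)) /=.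
rewrite [X in _ * X]big1 ?mulr1; last first.
  move=> k kt; rewrite -[RHS](m_sum1 (val k)); apply: eq_bigl => x.
  by apply/asboolP => kt'; rewrite kt' in kt.
(* The remaining modes of [s] are those of [t]; [insub] is the partial inverse of the inclusion. *)
rewrite (reindex_omap (fun k : {k | k \in t} => exist _ (val k) (ts _ (valP k)))
  (fun k => insub (val k))) /=; last first.
  by move=> k kt; rewrite insubT /=; congr Some; apply: val_inj.
apply: eq_big => [k|k _]; first by rewrite (valP k) valK eqxx.
rewrite (big_pred1 (j k)) // => x; apply/asboolP/eqP => /= [|-> kt].
  move/(_ (valP k)) ->; case: k {x} => k kt /=.
  by congr (j (exist _ k _)); apply: bool_irrelevance.
by case: k {x} kt => k kt kt' /=; congr (j (exist _ k _)); apply: bool_irrelevance.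
Qed.

Lemma sum_mass_tensor {R : realType} {I : finType} {n : I -> nat}
    {m : forall k, 'I_(n k) -> R} (m_sum1 : forall k, \sum_(i < n k) m k i = 1)
    (s : seq I) : \sum_(i : midx n s) mass_tensor m i = 1.
Proof.
have := sum_dffun_prod (fun (k : {k | k \in s}) (_ : 'I_(n (val k))) => true)
  (fun k => m (val k)).
rewrite [X in _ = X]big1 => [<-|k _]; last exact: m_sum1.
by apply: eq_bigl => i; apply/esym/forallP.
Qed.

Lemma first_moment_mass {R : realType} {I : finType} {n : I -> nat}
    {m : forall k, 'I_(n k) -> R} (m_sum1 : forall k, \sum_(i < n k) m k i = 1)
    {s : seq I} {S M : tensor R n s} (ME : forall i, M i = mass_tensor m i) :
  first_moment S M = inner S (mass_tensor m (s := _)).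
Proof.
have -> : M = mass_tensor m (s := s) by apply/funext.
rewrite /first_moment [X in _ / X](_ : _ = 1) ?divr1 //.
rewrite -[RHS](sum_mass_tensor m_sum1 s).
by apply: eq_bigr => i _; rewrite mul1r.
Qed.

Lemma inner_restrict {R : realType} {I : finType} {n : I -> nat}
    {m : forall k, 'I_(n k) -> R} (m_sum1 : forall k, \sum_(i < n k) m k i = 1)
    {s t : seq I} (ts : {subset t <= s}) (S : tensor R n t) :
  inner (fun i => S (midx_restrict ts i)) (mass_tensor m (s := s)) =
  inner S (mass_tensor m (s := _)).
Proof.
rewrite /inner (partition_big (midx_restrict ts) predT) //=.
apply: eq_bigr => j _; rewrite -(sum_mass_tensor_fiber m_sum1 ts) mulr_sumr.
by apply: eq_bigr => i /eqP ->.
Qed.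

(** Since [A] takes finitely many values, [F \o A] is the finite sum of the [F i] times the
    indicators of the events [A = i], and linearity of the integral applies. *)
Lemma expectation_joint_masses {R : realType} {I : finType} {n : I -> nat}
    {m : forall k, 'I_(n k) -> R} {d : measure_display}
    {Omega : measurableType d} {P : probability Omega R}
    {A : Omega -> midx n (enum I)} (A_law : has_joint_masses m P A)
    (F : tensor R n (enum I)) :
  ('E_P[F \o A] = (inner F (mass_tensor m (s := _)))%:E)%E.
Proof.
pose B i : set Omega := (A @^-1` [set i])%classic.
have mB i : measurable (B i) by case: (A_law i).
have intB i : P.-integrable setT (fun w => (\1_(B i) w)%:E) by exact: integrable_indic.
rewrite unlock.
transitivity (\int[P]_w (\sum_i (F i)%:E * (\1_(B i) w)%:E))%E.
  apply: eq_integral => w _; rewrite (bigD1 (A w)) //= big1 ?adde0.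
    by rewrite indicE mem_set // mule1.
  by move=> i iA; rewrite indicE memNset ?mule0 // => Ai; rewrite -Ai eqxx in iA.
rewrite integral_sum //; last by move=> i; apply: integrableZl.
rewrite /inner -sumEFin; apply: eq_bigr => i _.
by rewrite integralZl // integral_indic // setIT EFinM; case: (A_law i) => _ <-.
Qed.

Lemma sum_centered_mul (R : comPzRingType) (T : finType) (x y p : T -> R) :
  \sum_i p i = 1 ->
  \sum_i (x i - \sum_j x j * p j) * (y i - \sum_j y j * p j) * p i =
  \sum_i x i * y i * p i - (\sum_i x i * p i) * (\sum_i y i * p i).
Proof.
move=> p1; set a := \sum_j x j * p j; set b := \sum_j y j * p j.
(* Expanding the centered product leaves three terms equal to [a * b] up to sign; the last one needs
   total mass 1. *)
transitivity (\sum_i (x i * y i * p i - x i * p i * b - a * (y i * p i) + a * b * p i)).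
  by apply: eq_bigr => i _; ring.
by rewrite big_split !sumrB /= -mulr_suml -!mulr_sumr -/a -/b p1; ring.
Qed.

Theorem theorem3p6 (R : realType) (I : finType) (n : I -> nat)
    (m : forall k : I, 'I_(n k) -> R)
    (m_ge0 : forall (k : I) (i : 'I_(n k)), 0 <= m k i)
    (m_sum1 : forall k : I, \sum_(i < n k) m k i = 1)
    (IX IY : {set I}) (IXY : IX :|: IY = [set: I])
    (SX MX : tt R n (modes IX) 1) (SY MY : tt R n (modes IY) 1)
    (MZ : tt R n (enum I) 1)
    (MXE : forall i, tt_tensor MX i = mass_tensor m i)
    (MYE : forall i, tt_tensor MY i = mass_tensor m i)
    (MZE : forall i, tt_tensor MZ i = mass_tensor m i)
    (d : measure_display) (Omega : measurableType d) (P : probability Omega R)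
    (A : Omega -> midx n (enum I)) (A_law : has_joint_masses m P A) :
  let X := tensor_rv A (tt_tensor SX) in
  let Y := tensor_rv A (tt_tensor SY) in
  let SZ := tt_product SX SY in
  let muX := first_moment (tt_tensor SX) (tt_tensor MX) in
  let muY := first_moment (tt_tensor SY) (tt_tensor MY) in
  covariance P X Y =
    (inner (tt_tensor SZ) (tt_tensor MZ)
       / inner ones (tt_tensor MZ)
     - muX * muY)%:E.
Proof.
move=> X Y SZ muX muY.
pose FX i := tt_tensor SX (midx_restrict (@modes_sub I IX) i).
pose FY i := tt_tensor SY (midx_restrict (@modes_sub I IY) i).
have muXE : muX = inner FX (mass_tensor m (s := _)).
  by rewrite inner_restrict // /muX (first_moment_mass m_sum1).
have muYE : muY = inner FY (mass_tensor m (s := _)).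
  by rewrite inner_restrict // /muY (first_moment_mass m_sum1).
have EX : ('E_P[X] = muX%:E)%E.
  by rewrite muXE -(expectation_joint_masses A_law).
have EY : ('E_P[Y] = muY%:E)%E.
  by rewrite muYE -(expectation_joint_masses A_law).
rewrite covariance.unlock EX EY /=.
(* The quotient in the goal is the first moment of [SZ], whose denominator is again a total mass
   equal to 1. *)
rewrite -[_ / _]/(first_moment _ _) (first_moment_mass m_sum1) //.
(* The centered product is itself a function of the multi-index composed with [A], so its
   expectation is a finite sum. *)
rewrite -[((_ \- _) * _)]/((fun i => (FX i - muX) * (FY i - muY)) \o A).
rewrite (expectation_joint_masses A_law); congr EFin.
rewrite muXE muYE /inner sum_centered_mul ?sum_mass_tensor //; congr (_ - _).
by apply: eq_bigr => i _; rewrite tt_tensor_product.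
Qed.
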